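(* Let $\mathcal{A}=(\Sigma,Q,F,\Delta)$ be a $T$-shaped tree automaton. Then the polytope $P(\mathcal{A})$ has an extended formulation with $O(|Q|+|\Delta|)$ extension variables and $O(|Q|+|T|\cdot|\Sigma|)$ inequalities, where $|T|$ is the number of nodes of $T$.
   Context: An addressed tree $T$ is a rooted tree with node set $N(T)$, root $r$, in which the children of each node are numbered $1,\dots,s$. Let $\Sigma$ be a finite alphabet. A $T$-shaped term over $\Sigma$ is a map $\tau:N(T)\to\Sigma$. A $T$-shaped tree automaton is a tuple $\mathcal{A}=(\Sigma,Q,F,\Delta)$ where $Q$ is a finite set of states partitioned into cells $\{Q_u\}_{u\in N(T)}$, $F\subseteq Q_r$ is the set of final states, and $\Delta$ is a set of transitions partitioned into $\{\Delta_u\}_{u\in N(T)}$ with $\Delta_u\subseteq Q_{u_1}\times\dots\times Q_{u_s}\times\Sigma\times Q_u$, where $u_1,\dots,u_s$ are the children of $u$ in order. A trace for a term $\tau$ is a map $\rho:N(T)\to Q$ with $(\rho(u_1),\dots,\rho(u_s),\tau(u),\rho(u))\in\Delta_u$ for all $u$; it is accepting if $\rho(r)\in F$. $\mathcal{L}(\mathcal{A})$ is the set of $T$-shaped terms with an accepting trace. For a term $\tau$, $\hat\tau$ is the 0/1 vector over variables $\{x_{u,a}:u\in N(T),a\in\Sigma\}$ with $\hat\tau(x_{u,a})=1$ iff $\tau(u)=a$. $P(\mathcal{A})=\mathrm{conv}\{\hat\tau:\tau\in\mathcal{L}(\mathcal{A})\}$. A polytope $P'$ is an extended formulation of $P$ if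 $P$ is a projection of $P'$.
   Formalization: The sign conditions y ≥ 0 on the extension variables are not counted among the O(|Q|+|T|·|Σ|) inequalities (with them counted the bound fails, e.g. for edge polytopes of projective-plane incidence graphs), and the alphabet Σ is assumed nonempty. *)

(* Defs.v *)
From HB Require Import structures.
From mathcomp Require Import all_boot all_order all_algebra.

Set Implicit Arguments.
Unset Strict Implicit.
Unset Printing Implicit Defensive.

Import Order.TTheory GRing.Theory Num.Theory.
Local Open Scope ring_scope.

(* The i-th child of u is the i-th entry of [children u].  The last four fields
   say that the parent/child relation is a tree rooted at [root]. *)
Record addressed_tree := AddressedTree {
  node :> finType;
  root : node;
  children : node -> seq node;
  children_uniq : forall u, uniq (children u);
  parent_unique : forall u u' v,
    v \in children u -> v \in children u' -> u = u';
  root_orphan : forall u, root \notin children u;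
  root_connect : forall v, connect (fun u w => w \in children u) root v
}.

Definition term (T : addressed_tree) (Sigma : finType) := {ffun T -> Sigma}.

(* The partition of Q is given by the map [cell] sending a state to the node
   whose cell contains it.  A transition at u is a triple
   ((q_1, ..., q_s), a, q). *)
Record tree_automaton (T : addressed_tree) (Sigma : finType) := TreeAutomaton {
  state : finType;
  cell : state -> T;
  final : {set state};
  trans : forall u : T,
    {set ((size (children u)).-tuple state * Sigma * state)%type};
  final_root : forall q, q \in final -> cell q = root T;
  trans_cell : forall u t, t \in trans u ->
    map cell t.1.1 = children u /\ cell t.2 = u
}.

(* The sets [trans u] are pairwise disjoint as sets of transitions, the target
   of each transition at u being in the cell of u. *)
Definition ntrans (T : addressed_tree) (Sigma : finType)
    (A : tree_automaton T Sigma) : nat :=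
  (\sum_(u : T) #|trans A u|)%N.

Definition is_trace (T : addressed_tree) (Sigma : finType)
    (A : tree_automaton T Sigma) (tau : term T Sigma)
    (rho : {ffun T -> state A}) : Prop :=
  forall u : T,
    (map_tuple rho (in_tuple (children u)), tau u, rho u) \in trans A u.

Definition language (T : addressed_tree) (Sigma : finType)
    (A : tree_automaton T Sigma) (tau : term T Sigma) : Prop :=
  exists rho : {ffun T -> state A},
    is_trace tau rho /\ rho (root T) \in final A.

Definition term_vector (R : realFieldType) (T : addressed_tree)
    (Sigma : finType) (tau : term T Sigma) : {ffun T * Sigma -> R} :=
  [ffun v => (tau v.1 == v.2)%:R].

Definition convex_hull (R : realFieldType) (X : finType)
    (S : {ffun X -> R} -> Prop) (x : {ffun X -> R}) : Prop :=
  exists (n : nat) (p : 'I_n -> {ffun X -> R}) (c : 'I_n -> R),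
    [/\ forall i, S (p i), forall i, 0 <= c i, \sum_i c i = 1
      & forall v, x v = \sum_i c i * p i v].

Definition automaton_polytope (R : realFieldType) (T : addressed_tree)
    (Sigma : finType) (A : tree_automaton T Sigma) :
    {ffun T * Sigma -> R} -> Prop :=
  convex_hull (fun x : {ffun T * Sigma -> R} =>
    exists tau : term T Sigma, language A tau /\ x = term_vector R tau).

(* A system of [nineq] linear inequalities  C x + D y <= b  in the original
   variables x, indexed by X, and [nvar] nonnegative extension variables y.
   As usual for linear programs, the sign conditions y >= 0 are not counted
   among the inequalities; an equation counts as two inequalities, and the
   variables x are free. *)
Record linear_system (R : realFieldType) (X : finType) := LinearSystem {
  nvar : nat;
  nineq : nat;
  coef_orig : 'I_nineq -> X -> R;
  coef_ext : 'I_nineq -> 'I_nvar -> R;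
  rhs : 'I_nineq -> R
}.

Definition solution (R : realFieldType) (X : finType) (S : linear_system R X)
    (x : {ffun X -> R}) (y : {ffun 'I_(nvar S) -> R}) : Prop :=
  (forall i : 'I_(nineq S),
     \sum_v coef_orig i v * x v + \sum_j coef_ext i j * y j <= rhs i)
  /\ (forall j, 0 <= y j).

Definition bounded_system (R : realFieldType) (X : finType)
    (S : linear_system R X) : Prop :=
  exists M : R, forall (x : {ffun X -> R}) (y : {ffun 'I_(nvar S) -> R}),
    solution x y -> (forall v, `|x v| <= M) /\ (forall j, `|y j| <= M).

Definition extended_formulation (R : realFieldType) (X : finType)
    (S : linear_system R X) (P : {ffun X -> R} -> Prop) : Prop :=
  bounded_system S /\
  (forall x, P x <-> exists y : {ffun 'I_(nvar S) -> R}, solution x y).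

(* Main.v *)
From HB Require Import structures.
From mathcomp Require Import all_boot all_order all_algebra.
Require Import Defs.

Set Implicit Arguments.
Unset Strict Implicit.
Unset Printing Implicit Defensive.

Import Order.TTheory GRing.Theory Num.Theory.
Local Open Scope ring_scope.

(** A flow gives every transition [d] a nonnegative weight [z d] such that, at
    every non-final state, the weight of the transitions entering it equals
    the weight of the transitions using it as a source, while the transitions
    with a final target have total weight 1. Accepting runs are 0/1 flows.
    Conversely, from a transition of positive weight one climbs to the root
    and then descends to every leaf along transitions of positive weight, by
    conservation; subtracting the largest multiple of the run so obtained that
    leaves the weights nonnegative shrinks the support. Hence flows are the
    convex combinations of accepting runs, and the polytope of the automaton
    is the image of the flows under the linear map that sends [z] to the
    weights of the transitions reading [a] at [u]. *)

Lemma map_nth_index (U : eqType) (V : Type) (y0 : V) (t : seq U) (s : seq V) :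
  uniq t -> size s = size t -> [seq nth y0 s (index v t) | v <- t] = s.
Proof.
case: t => [_ /size0nil -> //|v0 t]; set t' := v0 :: t => uniq_t size_s.
apply: (@eq_from_nth _ y0); rewrite size_map -size_s // => i lt_i.
by rewrite (nth_map v0) -?size_s // index_uniq -?size_s.
Qed.

Section AddressedTree.

Variable T : addressed_tree.

Definition child : rel T := fun u v => v \in children u.

Lemma root_path_exists (v : T) :
  exists p, path child (root T) p && (last (root T) p == v).
Proof.
by have /connectP[p p_path ->] := root_connect v; exists p; rewrite p_path /=.
Qed.

Definition root_path (v : T) : seq T := xchoose (root_path_exists v).

Lemma path_root_path v : path child (root T) (root_path v).
Proof. by have /andP[] := xchooseP (root_path_exists v). Qed.

Lemma last_root_path v : last (root T) (root_path v) = v.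
Proof. by have /andP[_ /eqP] := xchooseP (root_path_exists v). Qed.

Lemma root_path_unique (p q : seq T) :
  path child (root T) p -> path child (root T) q ->
  last (root T) p = last (root T) q -> p = q.
Proof.
have no_return s v : path child (root T) (rcons s v) -> v <> root T.
  rewrite rcons_path => /andP[_ v_child] v_root.
  by move: v_child; rewrite /child v_root (negbTE (root_orphan _)).
elim/last_ind: p q => [|p v IHp] q; case/lastP: q => [|q w] //.
- by move=> _ /no_return neq; rewrite last_rcons => /esym.
- by move=> /no_return neq _; rewrite last_rcons.
rewrite !rcons_path !last_rcons => /andP[pp pv] /andP[pq qw] eq_vw.
by rewrite -eq_vw in qw *; rewrite (IHp q) // (parent_unique pv qw).
Qed.

Lemma root_path_root : root_path (root T) = [::].
Proof.
by apply: root_path_unique; [exact: path_root_path| |exact: last_root_path].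
Qed.

Lemma root_path_child u v :
  v \in children u -> root_path v = rcons (root_path u) v.
Proof.
move=> uv; apply: root_path_unique; first exact: path_root_path.
  by rewrite rcons_path path_root_path last_root_path.
by rewrite last_rcons last_root_path.
Qed.

Lemma top_down_ind (P : T -> Prop) :
  P (root T) -> (forall u v, v \in children u -> P u -> P v) -> forall v, P v.
Proof.
move=> P_root P_child v; rewrite -(last_root_path v).
elim/last_ind: (root_path v) (path_root_path v) => [//|p w IHp].
by rewrite rcons_path last_rcons => /andP[/IHp Pp pw]; exact: P_child pw Pp.
Qed.

Lemma card_parents v : v != root T -> #|[pred u : T | v \in children u]| = 1%N.
Proof.
elim/top_down_ind: v => [|u v uv _ _]; first by rewrite eqxx.
apply: (@eq_card1 _ u) => w; rewrite !inE.
by apply/idP/eqP => [wv|-> //]; exact: parent_unique wv uv.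
Qed.

Section TopDownRecursion.

Variables (Y : Type) (y0 : Y) (next : Y -> T -> Y).

Definition top_down_rec (v : T) : Y := foldl next y0 (root_path v).

Lemma top_down_rec_root : top_down_rec (root T) = y0.
Proof. by rewrite /top_down_rec root_path_root. Qed.

Lemma top_down_rec_child u v :
  v \in children u -> top_down_rec v = next (top_down_rec u) v.
Proof.
by move=> uv; rewrite /top_down_rec (root_path_child uv) foldl_rcons.
Qed.

End TopDownRecursion.

End AddressedTree.

Section FiniteVectors.

Variables (R : realFieldType) (X : finType).

Implicit Types (P : pred X) (z g : {ffun X -> R}).

Definition nonneg z : Prop := forall x, 0 <= z x.

Definition pos_support z : pred X := [pred x | 0 < z x].

Definition weight P z : R := \sum_(x | P x) z x.

Lemma weightE P z : weight P z = \sum_x (P x)%:R * z x.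
Proof.
rewrite /weight big_mkcond; apply: eq_bigr => x _.
by rewrite mulr_natl mulrb.
Qed.

Lemma weight_gt0P P z :
  nonneg z -> reflect (exists2 x, P x & 0 < z x) (0 < weight P z).
Proof.
move=> z_ge0; rewrite lt_def sumr_ge0 ?andbT => [|x _]; last exact: z_ge0.
rewrite psumr_neq0 => [|x _]; last exact: z_ge0.
apply: (iffP hasP) => [[x _ /andP[Px z_gt0]]|[x Px z_gt0]]; exists x => //.
by rewrite Px.
Qed.

Definition subtract_multiple z (a : R) g : {ffun X -> R} :=
  [ffun x => z x - a * g x].

Lemma weight_subtract_multiple P z a g :
  weight P (subtract_multiple z a g) = weight P z - a * weight P g.
Proof.
by rewrite /weight mulr_sumr -sumrB; apply: eq_bigr => x _; rewrite ffunE.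
Qed.

Definition linear_combination (I : finType) (c : I -> R)
    (f : I -> {ffun X -> R}) : {ffun X -> R} :=
  [ffun x => \sum_i c i * f i x].

Lemma weight_linear_combination (I : finType) (c : I -> R) f P :
  weight P (linear_combination c f) = \sum_i c i * weight P (f i).
Proof.
rewrite /weight; under eq_bigr do rewrite ffunE.
by rewrite exchange_big; apply: eq_bigr => i _; rewrite mulr_sumr.
Qed.

(* The multiple is the minimum of [z x / g x] over the support of [g]. *)
Lemma exists_support_shrinking_multiple z g :
  nonneg z -> nonneg g -> (exists x, 0 < g x) ->
  {subset pos_support g <= pos_support z} ->
  exists a, [/\ 0 <= a, nonneg (subtract_multiple z a g)
    & (#|pos_support (subtract_multiple z a g)| < #|pos_support z|)%N].
Proof.
move=> z_ge0 g_ge0 [x1 g_x1] g_z.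
have [x0 g_x0 min_x0] :=
  arg_minP (P := pos_support g) (fun x => z x / g x) g_x1.
set a := z x0 / g x0 in min_x0.
have a_ge0 : 0 <= a by rewrite divr_ge0.
exists a; split=> // [x|].
  rewrite ffunE subr_ge0; have [g_x|g_x] := ltP 0 (g x).
    by rewrite -ler_pdivlMr // min_x0.
  by rewrite (le_trans _ (z_ge0 x)) // mulr_ge0_le0.
apply: proper_card; apply/properP; split.
  apply/subsetP=> x; rewrite !inE ffunE => /lt_le_trans; apply.
  by rewrite gerBl mulr_ge0.
exists x0; rewrite !inE; first exact: g_z.
by rewrite ffunE divfK ?gt_eqF // subrr ltxx.
Qed.

Lemma conic_decomposition (I : finType) (f : I -> {ffun X -> R})
    (K : {ffun X -> R} -> Prop) :
  (forall i, nonneg (f i)) ->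
  (forall z a i, K z -> K (subtract_multiple z a (f i))) ->
  (forall z x, nonneg z -> K z -> 0 < z x ->
     exists i, (exists y, 0 < f i y) /\
       {subset pos_support (f i) <= pos_support z}) ->
  forall z, nonneg z -> K z ->
    exists2 c : I -> R, forall i, 0 <= c i & z = linear_combination c f.
Proof.
move=> f_ge0 K_sub K_gen z.
have [n] := ubnP #|pos_support z|; elim: n z => // n IHn z.
rewrite ltnS => le_n z_ge0 Kz.
have [/existsP[x z_x]|/existsPn z_le0] := boolP [exists x, 0 < z x]; last first.
  exists (fun=> 0) => //; apply/ffunP=> x; rewrite ffunE big1 => [|i _].
    by apply/eqP; rewrite eq_le z_ge0 leNgt z_le0.
  by rewrite mul0r.
have [i0 [f_i0 f_z]] := K_gen z x z_ge0 Kz z_x.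
have [a [a_ge0 rest_ge0 card_lt]] :=
  exists_support_shrinking_multiple z_ge0 (f_ge0 i0) f_i0 f_z.
have [c c_ge0 rest_eq] :=
  IHn _ (leq_trans card_lt le_n) rest_ge0 (K_sub _ _ _ Kz).
exists (fun i => c i + (i == i0)%:R * a) => [i|].
  by rewrite addr_ge0 // mulr_ge0.
apply/ffunP=> y; rewrite ffunE; under eq_bigr do rewrite mulrDl.
have peeled : \sum_i (i == i0)%:R * a * f i y = a * f i0 y.
  rewrite (bigD1 i0) //= eqxx mul1r big1 ?addr0 // => i /negbTE ->.
  by rewrite !mul0r.
have /ffunP/(_ y) := rest_eq; rewrite big_split /= peeled !ffunE => <-.
by rewrite subrK.
Qed.

Definition convex_weights (I : finType) (c : I -> R) : Prop :=
  (forall i, 0 <= c i) /\ \sum_i c i = 1.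

Lemma norm_linear_combination_le (I : finType) (c : I -> R)
    (f : I -> {ffun X -> R}) M x :
  convex_weights c -> (forall i, `|f i x| <= M) ->
  `|linear_combination c f x| <= M.
Proof.
case=> c_ge0 c_sum f_le; rewrite ffunE -[M]mul1r -c_sum mulr_suml.
apply: le_trans (ler_norm_sum _ _ _) _; apply: ler_sum => i _.
by rewrite normrM (ger0_norm (c_ge0 i)) ler_wpM2l.
Qed.

Lemma convex_hull_rangeP (I : finType) (f : I -> {ffun X -> R}) S x :
  (forall y, S y <-> exists i, y = f i) ->
  convex_hull S x <-> exists2 c, convex_weights c & x = linear_combination c f.
Proof.
move=> S_range; split=> [[n [p [c [Sp c_ge0 c_sum xE]]]]|[c [c_ge0 c_sum] ->]].
  have /fin_all_exists[idx pE] k : exists i, p k = f i by apply/S_range.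
  exists (fun i => \sum_(k | idx k == i) c k); first split=> [i|].
  - exact: sumr_ge0.
  - by rewrite -c_sum [RHS](partition_big idx predT).
  apply/ffunP=> v; rewrite xE ffunE (partition_big idx predT) //=.
  apply: eq_bigr => i _; rewrite mulr_suml.
  by apply: eq_bigr => k /eqP <-; rewrite pE.
exists #|I|, (fun k => f (enum_val k)), (fun k => c (enum_val k)).
split=> [k|k||v].
- by apply/S_range; exists (enum_val k).
- exact: c_ge0.
- by rewrite -(big_enum_val (A := I) c).
by rewrite ffunE -(big_enum_val (A := I) (fun i => c i * f i v)).
Qed.

End FiniteVectors.

Section EquationSystem.

Variables (R : realFieldType) (X E J : finType).
Variables (C : E -> X -> R) (D : E -> J -> R) (b : E -> R).

Definition equation_solution (x : {ffun X -> R}) (z : {ffun J -> R}) : Prop :=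
  nonneg z /\ forall e, \sum_v C e v * x v + \sum_j D e j * z j = b e.

Definition equation_system : linear_system R X :=
  @LinearSystem R X #|J| #|{: bool * E}|
    (fun i x => (-1) ^+ (enum_val i).1 * C (enum_val i).2 x)
    (fun i j => (-1) ^+ (enum_val i).1 * D (enum_val i).2 (enum_val j))
    (fun i => (-1) ^+ (enum_val i).1 * b (enum_val i).2).

Lemma equation_systemP (x : {ffun X -> R})
    (y : {ffun 'I_(nvar equation_system) -> R}) :
  solution x y <-> equation_solution x [ffun j => y (enum_rank j)].
Proof.
set z := [ffun j => y (enum_rank j)].
have lhsE (i : 'I_(nineq equation_system)) :
    \sum_v coef_orig i v * x v + \sum_j coef_ext i j * y j
    = (-1) ^+ (enum_val i).1 * (\sum_v C (enum_val i).2 v * x v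
        + \sum_j D (enum_val i).2 j * z j).
  rewrite mulrDr !mulr_sumr; congr (_ + _).
    by apply: eq_bigr => v _; rewrite mulrA.
  rewrite [RHS](big_enum_val (A := J)); apply: eq_bigr => j _.
  by rewrite ffunE enum_valK mulrA.
split=> [[ineq y_ge0]|[z_ge0 eqs]]; last first.
  split=> [i|j]; first by rewrite lhsE eqs.
  by have := z_ge0 (enum_val j); rewrite ffunE enum_valK.
split=> [j|e]; first by rewrite ffunE.
apply/eqP; rewrite eq_le; apply/andP; split.
  by have := ineq (enum_rank (false, e)); rewrite lhsE /= enum_rankK /= !mul1r.
have := ineq (enum_rank (true, e)).
by rewrite lhsE /= enum_rankK /= !mulN1r lerN2.
Qed.

Lemma equation_system_formulation (P : {ffun X -> R} -> Prop) :
  (exists M, forall x z, equation_solution x z ->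
     (forall v, `|x v| <= M) /\ (forall j, `|z j| <= M)) ->
  (forall x, P x <-> exists z, equation_solution x z) ->
  extended_formulation equation_system P.
Proof.
move=> [M bounded_by] P_proj; split.
  exists M => x y /equation_systemP/bounded_by[x_le z_le]; split=> // j.
  by have := z_le (enum_val j); rewrite ffunE enum_valK.
move=> x; split=> [/P_proj[z xz]|[y /equation_systemP xz]]; last first.
  by apply/P_proj; exists [ffun j => y (enum_rank j)].
exists [ffun i => z (enum_val i)]; apply/equation_systemP.
suff -> : [ffun j => [ffun i => z (enum_val i)] (enum_rank j)] = z by [].
by apply/ffunP=> j; rewrite !ffunE enum_rankK.
Qed.

End EquationSystem.

Section Runs.

Variables (T : addressed_tree) (Sigma : finType) (A : tree_automaton T Sigma).

Definition transition : finType :=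
  {u : T & {t : (size (children u)).-tuple (state A) * Sigma * state A
          | t \in trans A u}}.

Definition sources (d : transition) : seq (state A) := (val (tagged d)).1.1.
Definition label (d : transition) : Sigma := (val (tagged d)).1.2.
Definition target (d : transition) : state A := (val (tagged d)).2.

Implicit Types (d : transition) (q : state A) (u v : T).

Lemma card_transition : #|transition| = ntrans A.
Proof.
rewrite card_tagged sumnE big_map big_enum; apply: eq_bigr => u _.
by rewrite card_sig; apply: eq_card.
Qed.

Lemma map_cell_sources d : map (@cell _ _ A) (sources d) = children (tag d).
Proof. by have [] := trans_cell (valP (tagged d)). Qed.

Lemma cell_target d : cell (target d) = tag d.
Proof. by have [] := trans_cell (valP (tagged d)). Qed.

Lemma cell_source d q : q \in sources d -> cell q \in children (tag d).
Proof. by move=> qd; rewrite -map_cell_sources map_f. Qed.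

Lemma source_not_final d q : q \in sources d -> q \notin final A.
Proof.
move/cell_source; apply: contraTN => /final_root ->; exact: root_orphan.
Qed.

(* The default value is irrelevant: [v] is meant to be a child of [tag d]. *)
Definition source_at d v : state A :=
  nth (target d) (sources d) (index v (children (tag d))).

Lemma map_source_at d : [seq source_at d v | v <- children (tag d)] = sources d.
Proof.
by apply: map_nth_index (children_uniq _) _; rewrite -map_cell_sources size_map.
Qed.

Lemma mem_source_at d v : v \in children (tag d) -> source_at d v \in sources d.
Proof. by move=> vd; rewrite -[sources d]map_source_at map_f. Qed.

Lemma cell_source_at d v : v \in children (tag d) -> cell (source_at d v) = v.
Proof.
move=> vd; rewrite /source_at -(nth_map _ v) ?map_cell_sources ?nth_index //.
by rewrite -(size_map (@cell _ _ A)) map_cell_sources index_mem.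
Qed.

Definition is_run (r : {ffun T -> transition}) : bool :=
  [&& [forall u, tag (r u) == u],
      [forall u, sources (r u) == [seq target (r v) | v <- children u]]
    & target (r (root T)) \in final A].

Record run := Run { run_fun :> {ffun T -> transition}; runP : is_run run_fun }.

HB.instance Definition _ := [isSub of run for run_fun].
HB.instance Definition _ := [Finite of run by <:].

Implicit Type r : run.

Lemma run_tag r u : tag (r u) = u.
Proof. by have /and3P[/forallP/(_ u)/eqP] := runP r. Qed.

Lemma run_sources r u : sources (r u) = [seq target (r v) | v <- children u].
Proof. by have /and3P[_ /forallP/(_ u)/eqP] := runP r. Qed.

Lemma run_final r : target (r (root T)) \in final A.
Proof. by have /and3P[] := runP r. Qed.

Lemma cell_run_target r u : cell (target (r u)) = u.
Proof. by rewrite cell_target run_tag. Qed.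

Lemma run_target_eq r u q :
  (target (r u) == q) = (target (r (cell q)) == q) && (u == cell q).
Proof.
apply/eqP/andP=> [<-|[/eqP target_q /eqP -> //]].
by rewrite cell_run_target !eqxx.
Qed.

Lemma mem_run_sources r u q :
  (q \in sources (r u)) = (target (r (cell q)) == q) && (cell q \in children u).
Proof.
rewrite run_sources; apply/mapP/andP=> [[v vu ->]|[/eqP target_q qu]].
  by rewrite cell_run_target eqxx.
by exists (cell q).
Qed.

Definition run_term r : term T Sigma := [ffun u => label (r u)].

Lemma run_language r : language A (run_term r).
Proof.
exists [ffun u => target (r u)]; split; last by rewrite ffunE run_final.
move=> u; have := run_sources r u; have := run_tag r u.
rewrite !ffunE /sources /label /target.
case: (r u) => w [[[s a] q] t_in] /= eq_w; rewrite {w}eq_w in s t_in * => s_eq.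
suff -> : map_tuple [ffun v => target (r v)] (in_tuple (children u)) = s by [].
by apply: val_inj; rewrite /= s_eq; apply: eq_map => v; rewrite ffunE.
Qed.

Lemma languageP tau : language A tau <-> exists r, tau = run_term r.
Proof.
split=> [[rho [tr fin]]|[r ->]]; last exact: run_language.
pose step u : transition :=
  Tagged (fun u => {t | t \in trans A u})
    (exist (fun t => t \in trans A u) _ (tr u)).
have step_run : is_run [ffun u => step u].
  apply/and3P; split; last by rewrite ffunE.
    by apply/forallP=> u; rewrite ffunE.
  by apply/forallP=> u; rewrite ffunE; apply/eqP/eq_map=> v; rewrite ffunE.
by exists (Run step_run); apply/ffunP=> u; rewrite !ffunE.
Qed.

End Runs.

Section Flow.

Variables (T : addressed_tree) (Sigma : finType) (A : tree_automaton T Sigma).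

Implicit Types (d : transition A) (q : state A) (r : run A) (w : T * Sigma).

Definition entering q : pred (transition A) := fun d => target d == q.
Definition leaving q : pred (transition A) := fun d => q \in sources d.
Definition accepting : pred (transition A) := fun d => target d \in final A.
Definition reading w : pred (transition A) :=
  fun d => (tag d == w.1) && (label d == w.2).

Variable R : realFieldType.

Implicit Types (z : {ffun transition A -> R}) (x : {ffun T * Sigma -> R}).

Definition conserved z : Prop := forall q, q \notin final A ->
  weight (entering q) z = weight (leaving q) z.

Definition is_flow x z : Prop :=
  [/\ nonneg z, conserved z, weight accepting z = 1
    & forall w, x w = weight (reading w) z].

Definition run_flow r : {ffun transition A -> R} :=
  [ffun d => (d == r (tag d))%:R].

Lemma nonneg_run_flow r : nonneg (run_flow r).
Proof. by move=> d; rewrite ffunE ler0n. Qed.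

Lemma weight_run_flow P r : weight P (run_flow r) = #|[pred u | P (r u)]|%:R.
Proof.
rewrite /weight (partition_big (fun d => tag d) predT) //= -sum1_card natr_sum.
rewrite big_mkcond [RHS]big_mkcond; apply: eq_bigr => u _ /=.
rewrite big_mkcond (bigD1 (r u)) //= big1 ?addr0 => [|d d_neq].
  by rewrite ffunE run_tag !eqxx andbT inE.
case: ifP => // /andP[_ /eqP tag_d].
by rewrite ffunE tag_d (negbTE d_neq).
Qed.

Lemma conserved_run_flow r : conserved (run_flow r).
Proof.
move=> q qF; rewrite !weight_run_flow /entering /leaving; congr _%:R.
have [target_q|/negbTE no_q] := eqVneq (target (r (cell q))) q; last first.
  rewrite !eq_card0 // => u; first by rewrite !inE mem_run_sources no_q.
  by rewrite !inE run_target_eq no_q.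
have /card_parents cell_q_parent : cell q != root T.
  by apply: contraNneq qF => q_root; rewrite -target_q q_root run_final.
transitivity 1%N; last rewrite -cell_q_parent.
  apply: (@eq_card1 _ (cell q)) => u.
  by rewrite !inE run_target_eq target_q eqxx.
by apply: eq_card => u; rewrite !inE mem_run_sources target_q eqxx.
Qed.

Lemma accepting_weight_run_flow r : weight accepting (run_flow r) = 1.
Proof.
rewrite weight_run_flow (@eq_card1 _ (root T)) // => u; rewrite !inE /accepting.
apply/idP/eqP => [/final_root|->]; last exact: run_final.
by rewrite cell_run_target.
Qed.

Lemma reading_weight_run_flow r w :
  weight (reading w) (run_flow r) = term_vector R (run_term r) w.
Proof.
rewrite weight_run_flow !ffunE /reading; congr _%:R.
have [label_w|/negbTE label_neq] := eqVneq.
  apply: (@eq_card1 _ w.1) => u; rewrite !inE run_tag.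
  by apply/andP/eqP => [[/eqP]|->]; rewrite ?label_w ?eqxx.
apply: eq_card0 => u; rewrite !inE run_tag.
by have [->|//] := eqVneq; rewrite label_neq.
Qed.

Definition live z q : bool := 0 < weight (entering q) z.

Section PositiveRun.

Variable z : {ffun transition A -> R}.
Hypotheses (z_ge0 : nonneg z) (z_conserved : conserved z).

Lemma live_target d : 0 < z d -> live z (target d).
Proof. by move=> z_d; apply/weight_gt0P => //; exists d; rewrite /entering. Qed.

Lemma live_source d q : 0 < z d -> q \in sources d -> live z q.
Proof.
move=> z_d qd; rewrite /live z_conserved ?(source_not_final qd) //.
by apply/weight_gt0P => //; exists d.
Qed.

Lemma live_parent q : live z q -> q \notin final A ->
  exists2 q', live z q' & cell q \in children (cell q').
Proof.
rewrite /live => /[swap] /z_conserved -> /weight_gt0P[//|d qd z_d].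
exists (target d); first exact: live_target.
by rewrite cell_target cell_source.
Qed.

Lemma exists_live_final q : live z q -> exists2 q0, q0 \in final A & live z q0.
Proof.
move cell_q: (cell q) => v.
elim/top_down_ind: v q cell_q => [|u v uv IHu] q cell_q live_q.
  exists q => //; apply/negPn/negP=> /(live_parent live_q)[q' _].
  by rewrite cell_q (negbTE (root_orphan _)).
have [qF|/(live_parent live_q)[q' live_q']] := boolP (q \in final A).
  by exists q.
by rewrite cell_q => vq'; apply: IHu live_q'; exact: parent_unique vq' uv.
Qed.

Section Descent.

Variables (next : state A -> transition A) (q0 : state A).
Hypothesis target_next : forall q, live z q -> target (next q) = q.
Hypothesis next_gt0 : forall q, live z q -> 0 < z (next q).
Hypotheses (q0_final : q0 \in final A) (q0_live : live z q0).

Definition descent_state : T -> state A :=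
  top_down_rec q0 (fun q v => source_at (next q) v).

Lemma descent_stateP u : cell (descent_state u) = u /\ live z (descent_state u).
Proof.
elim/top_down_ind: u => [|u v uv [cell_u live_u]].
  by rewrite /descent_state top_down_rec_root (final_root q0_final).
rewrite /descent_state (top_down_rec_child _ _ uv) -/(descent_state u).
have v_next : v \in children (tag (next (descent_state u))).
  by rewrite -cell_target target_next // cell_u.
rewrite cell_source_at //; split=> //.
exact: live_source (next_gt0 live_u) (mem_source_at v_next).
Qed.

Lemma descent_is_run : is_run [ffun u => next (descent_state u)].
Proof.
have target_descent u : target (next (descent_state u)) = descent_state u.
  by rewrite target_next //; have [] := descent_stateP u.
have tag_descent u : tag (next (descent_state u)) = u.
  by rewrite -cell_target target_descent; have [] := descent_stateP u.
apply/and3P; split.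
- by apply/forallP=> u; rewrite ffunE tag_descent.
- apply/forallP=> u; rewrite ffunE -map_source_at tag_descent.
  apply/eqP/eq_in_map=> v uv; rewrite ffunE target_descent.
  by rewrite /descent_state (top_down_rec_child _ _ uv).
by rewrite ffunE target_descent /descent_state top_down_rec_root.
Qed.

End Descent.

Lemma exists_positive_run d0 : 0 < z d0 -> exists r, forall u, 0 < z (r u).
Proof.
move=> z_d0; have [q0 q0_final q0_live] := exists_live_final (live_target z_d0).
have /fin_all_exists2[next target_next next_gt0] q :
    exists2 d, live z q -> target d = q & live z q -> 0 < z d.
  have [/weight_gt0P[//|d /eqP target_d z_d]|_] := boolP (live z q).
    by exists d.
  by exists d0.
have run_next := descent_is_run target_next next_gt0 q0_final q0_live.
exists (Run run_next) => u; rewrite ffunE next_gt0 //.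
by have [] := descent_stateP target_next next_gt0 q0_final q0_live u.
Qed.

End PositiveRun.

Lemma conserved_decomposition z : nonneg z -> conserved z ->
  exists2 c, forall r, 0 <= c r & z = linear_combination c run_flow.
Proof.
move=> z_ge0 z_conserved; apply: (@conic_decomposition _ _ _ _ conserved) => //.
- exact: nonneg_run_flow.
- move=> g a r g_conserved q qF; rewrite !weight_subtract_multiple.
  by rewrite g_conserved // conserved_run_flow.
move=> g d g_ge0 g_conserved /(exists_positive_run g_ge0 g_conserved)[r g_r].
exists r; split=> [|d'].
  by exists (r (root T)); rewrite ffunE run_tag eqxx ltr01.
by rewrite !inE ffunE; case: eqP => [->|]; rewrite ?g_r ?ltxx.
Qed.

Lemma is_flowP x z : is_flow x z <-> exists c,
  [/\ convex_weights c, z = linear_combination c run_flow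
    & x = linear_combination c (fun r => term_vector R (run_term r))].
Proof.
split=> [[z_ge0 z_conserved z_accepting xE]|[c [[c_ge0 c_sum] -> ->]]].
  have [c c_ge0 zE] := conserved_decomposition z_ge0 z_conserved.
  exists c; split=> //; first split=> //.
    rewrite -z_accepting zE weight_linear_combination.
    by apply: eq_bigr => r _; rewrite accepting_weight_run_flow mulr1.
  apply/ffunP=> w; rewrite xE zE weight_linear_combination ffunE.
  by apply: eq_bigr => r _; rewrite reading_weight_run_flow.
split=> [d|q qF||w].
- by rewrite ffunE sumr_ge0 // => r _; rewrite mulr_ge0 // nonneg_run_flow.
- rewrite !weight_linear_combination.
  by apply: eq_bigr => r _; rewrite conserved_run_flow.
- rewrite weight_linear_combination -c_sum.
  by apply: eq_bigr => r _; rewrite accepting_weight_run_flow mulr1.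
rewrite weight_linear_combination ffunE.
by apply: eq_bigr => r _; rewrite reading_weight_run_flow.
Qed.

Lemma automaton_polytopeP x :
  automaton_polytope A x <-> exists z, is_flow x z.
Proof.
have range y : (exists tau, language A tau /\ y = term_vector R tau) <->
    exists r, y = term_vector R (run_term r).
  split=> [[tau [/languageP[r ->] ->]]|[r ->]]; first by exists r.
  by exists (run_term r); split=> //; exact: run_language.
apply: (iff_trans (convex_hull_rangeP x range)).
split=> [[c c_convex xE]|[z /is_flowP[c [c_convex _ xE]]]]; last by exists c.
by exists (linear_combination c run_flow); apply/is_flowP; exists c.
Qed.

Lemma is_flow_norm_le1 x z :
  is_flow x z -> (forall w, `|x w| <= 1) /\ (forall d, `|z d| <= 1).
Proof.
have norm_natb (b : bool) : `|b%:R : R| <= 1.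
  by case: b; rewrite ?normr1 ?normr0.
case/is_flowP=> c [c_convex -> ->].
by split=> ?; apply: norm_linear_combination_le => // r; rewrite ffunE.
Qed.

Definition flow_equation : finType := ((T * Sigma) + option (state A))%type.

Definition flow_coef_orig (e : flow_equation) w : R :=
  if e is inl w' then (w == w')%:R else 0.

Definition flow_coef_ext (e : flow_equation) d : R :=
  match e with
  | inl w => - (reading w d)%:R
  | inr (Some q) =>
      if q \in final A then 0 else (entering q d)%:R - (leaving q d)%:R
  | inr None => (accepting d)%:R
  end.

Definition flow_rhs (e : flow_equation) : R := if e is inr None then 1 else 0.

Definition flow_system : linear_system R (T * Sigma)%type :=
  equation_system flow_coef_orig flow_coef_ext flow_rhs.

Lemma flow_lhsE (e : flow_equation) x z :
  \sum_w flow_coef_orig e w * x w + \sum_d flow_coef_ext e d * z d =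
  match e with
  | inl w => x w - weight (reading w) z
  | inr (Some q) =>
      if q \in final A then 0 else weight (entering q) z - weight (leaving q) z
  | inr None => weight accepting z
  end.
Proof.
case: e => [w|e] /=.
  rewrite (bigD1 w) //= eqxx mul1r big1 ?addr0 => [|w' /negbTE ->]; last first.
    by rewrite mul0r.
  rewrite weightE -sumrN; congr (_ + _).
  by apply: eq_bigr => d _; rewrite mulNr.
rewrite big1 ?add0r => [|w _]; last by rewrite mul0r.
case: e => [q|]; last by rewrite weightE.
case: ifP => _; first by rewrite big1 // => d _; rewrite mul0r.
by rewrite !weightE -sumrB; apply: eq_bigr => d _; rewrite mulrBl.
Qed.

Lemma flow_equationsP x z :
  equation_solution flow_coef_orig flow_coef_ext flow_rhs x z <-> is_flow x z.
Proof.
split=> [[z_ge0 eqs]|[z_ge0 z_conserved z_accepting xE]].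
  split=> // [q /negbTE qF||w]; apply/eqP; rewrite -subr_eq0.
  - by have := eqs (inr (Some q)); rewrite flow_lhsE qF => /= ->.
  - by have := eqs (inr None); rewrite flow_lhsE => /= ->; rewrite subrr.
  by have := eqs (inl w); rewrite flow_lhsE => /= ->.
split=> // -[w|[q|]]; rewrite flow_lhsE //=; first by rewrite xE subrr.
by case: ifPn => // qF; rewrite z_conserved // subrr.
Qed.

Lemma flow_system_formulation :
  extended_formulation flow_system (@automaton_polytope R T Sigma A).
Proof.
apply: equation_system_formulation => [|x].
  by exists 1 => x z /flow_equationsP/is_flow_norm_le1.
apply: (iff_trans (automaton_polytopeP x)).
by split=> -[z /flow_equationsP xz]; exists z.
Qed.

Lemma nvar_flow_system : nvar flow_system = ntrans A.
Proof. exact: card_transition. Qed.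

Lemma nineq_flow_system :
  nineq flow_system = (2 * (#|T| * #|Sigma| + #|state A|.+1))%N.
Proof. by rewrite /= card_prod card_bool card_sum card_prod card_option. Qed.

End Flow.

Theorem theorem4p1 :
  exists K : nat,
    forall (R : realFieldType) (T : addressed_tree) (Sigma : finType)
           (A : tree_automaton T Sigma),
      (0 < #|Sigma|)%N ->
      exists S : linear_system R (T * Sigma)%type,
        [/\ extended_formulation S (@automaton_polytope R T Sigma A),
            (nvar S <= K * (#|state A| + ntrans A))%N
          & (nineq S <= K * (#|state A| + #|T| * #|Sigma|))%N].
Proof.
exists 4 => R T Sigma A Sigma_gt0; exists (flow_system A R).
split; first exact: flow_system_formulation.
  by rewrite nvar_flow_system mulnDr (leq_trans _ (leq_addl _ _)) ?leq_pmull.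
have cells_gt0 : (0 < #|T| * #|Sigma|)%N.
  by rewrite muln_gt0 Sigma_gt0 andbT; apply/card_gt0P; exists (root T).
rewrite nineq_flow_system -[4]/(2 * 2)%N -mulnA leq_pmul2l // mul2n -addnn.
by rewrite addnS addnC -addn1 leq_add2l addn_gt0 cells_gt0 orbT.
Qed.
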